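(* Let $\Sigma$ be a finite alphabet. For every language $L\subseteq\Sigma^*$, the following assertions are equivalent: 1. $L$ is regular; 2. $\mathcal H_L$ has finite rank; 3. $\mathcal H_L$ is compact.
   Context: All Banach spaces are real. $\Sigma$ is a finite nonempty alphabet, $\Sigma^*$ the free monoid of finite words over $\Sigma$; $\mathbf 1_L$ is the characteristic function of $L$. A language is regular if it is recognized by a finite deterministic automaton. $\ell_1(\Sigma^* )$ is the space of absolutely summable real families indexed by $\Sigma^*$ with norm $\|a\|_1=\sum_u|a(u)|$; $\ell_\infty(\Sigma^* )$ is the space of bounded real functions on $\Sigma^*$ with the supremum norm. The language Hankel operator is the bounded linear operator $\mathcal H_L:\ell_1(\Sigma^* )\to\ell_\infty(\Sigma^* )$ defined by $(\mathcal H_La)(v)=\sum_{u\in\Sigma^*}a(u)\mathbf 1_L(uv)$ for $v\in\Sigma^*$. *)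

(* Defs.v *)
From HB Require Import structures.
From mathcomp Require Import all_boot all_order all_algebra finmap.
From mathcomp Require Import all_classical all_reals all_analysis.
From mathcomp Require summability.

Set Implicit Arguments.
Unset Strict Implicit.
Unset Printing Implicit Defensive.

Import Order.TTheory GRing.Theory Num.Theory numFieldNormedType.Exports.

Local Open Scope classical_set_scope.
Local Open Scope ring_scope.

Record dfa (Sigma : finType) := Dfa {
  dfa_state : finType;
  dfa_init : dfa_state;
  dfa_trans : dfa_state -> Sigma -> dfa_state;
  dfa_final : {set dfa_state} }.

Definition dfa_accepts (Sigma : finType) (M : dfa Sigma) (w : seq Sigma) : bool :=
  foldl (@dfa_trans _ M) (dfa_init M) w \in dfa_final M.

Definition regular (Sigma : finType) (L : set (seq Sigma)) : Prop :=
  exists M : dfa Sigma, L = [set w | dfa_accepts M w].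

Section operators.
Context {R : realType}.

(* [S] is the linear span of a finite family; the family need not be free. *)
Definition finite_dimensional (W : lmodType R) (S : set W) : Prop :=
  exists (n : nat) (e : 'I_n -> W),
    S = [set w | exists c : 'I_n -> R, w = \sum_(i < n) c i *: e i].

Definition finite_rank (V W : lmodType R) (f : {linear V -> W}) : Prop :=
  finite_dimensional (range f).

Definition compact_operator (V W : normedModType R) (f : {linear V -> W}) : Prop :=
  forall A : set V, bounded_set A -> precompact (f @` A).

End operators.

(* [summability.sum a] is the limit of the partial sums of [a] along the directed
   set of finite subsets of the index type. *)

#[export] Existing Instance summability.totally_filter.

Section families.
Context {T : choiceType} {R : realType}.
Implicit Types (a b : T -> R) (c M : R).

Definition abs_summable a : Prop := summable [set: T] (EFin \o a).

Definition l1_norm a : R := fine (\esum_(x in [set: T]) `|(a x)%:E|)%E.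

Definition linf_norm a : R := sup (range (fun x => `|a x|)).

Local Notation psum := summability.partial_sum.
Local Notation abs a := (fun x => `|a x|).

Lemma psumE a (A : {fset T}) : psum a A = \sum_(x <- A) a x.
Proof. by rewrite /psum -(big_seq_fsetE _ A predT a). Qed.

Lemma psum_le_l1_norm a (A : {fset T}) :
  abs_summable a -> psum (abs a) A <= l1_norm a.
Proof.
rewrite /abs_summable summableE /l1_norm => sa.
rewrite -lee_fin fineK//= psumE -sumEFin; apply: ereal_sup_ubound.
exists [set` A]; first by split => //; exact: finite_fset.
by rewrite fsbig_finite//= ?set_fsetK//; exact: finite_fset.
Qed.

Lemma l1_norm_ge0 a : 0 <= l1_norm a.
Proof. by apply: fine_ge0; apply: esum_ge0 => x _; exact: abse_ge0. Qed.

Lemma esum_le_psum_ub a M : (forall A : {fset T}, psum (abs a) A <= M) ->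
  (\esum_(x in [set: T]) `|(a x)%:E| <= M%:E)%E.
Proof.
move=> aM; apply: ge_ereal_sup => _ [F [finF _] <-].
rewrite fsbig_finite//= (eq_bigr (fun x => (`|a x|)%:E))//.
by rewrite sumEFin lee_fin -psumE.
Qed.

Lemma abs_summable_psum_ub a M :
  (forall A : {fset T}, psum (abs a) A <= M) -> abs_summable a.
Proof.
by move=> /esum_le_psum_ub aM; apply: (le_lt_trans aM); rewrite ltry.
Qed.

Lemma l1_norm_psum_ub a M :
  (forall A : {fset T}, psum (abs a) A <= M) -> l1_norm a <= M.
Proof.
move=> aM; have := abs_summable_psum_ub aM.
rewrite /abs_summable summableE => sa.
by rewrite -lee_fin fineK//; exact: esum_le_psum_ub.
Qed.

Lemma psum_linear c a b (A : {fset T}) :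
  psum (c *: a + b) A = c * psum a A + psum b A.
Proof. by rewrite !psumE mulr_sumr -big_split. Qed.

Lemma le_psum a b (A : {fset T}) : (forall x, a x <= b x) -> psum a A <= psum b A.
Proof. by move=> ab; apply: ler_sum. Qed.

Lemma psum_abs_linear c a b (A : {fset T}) :
  psum (abs (c *: a + b)) A <= `|c| * psum (abs a) A + psum (abs b) A.
Proof.
rewrite -psum_linear; apply: le_psum => x.
by rewrite (le_trans (ler_normD _ _))// normrM.
Qed.

Lemma abs_summable_linear c a b :
  abs_summable a -> abs_summable b -> abs_summable (c *: a + b).
Proof.
move=> sa sb; apply: (@abs_summable_psum_ub _ (`|c| * l1_norm a + l1_norm b)) => A.
rewrite (le_trans (psum_abs_linear _ _ _ _))// lerD ?psum_le_l1_norm//.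
by rewrite ler_wpM2l// psum_le_l1_norm.
Qed.

Lemma abs_summable0 : abs_summable (0 : T -> R).
Proof.
apply: (@abs_summable_psum_ub _ 0) => A; rewrite psumE big1// => x _.
by rewrite normr0.
Qed.

Lemma abs_summable_le a b : (forall x, `|a x| <= `|b x|) ->
  abs_summable b -> abs_summable a.
Proof.
move=> ab sb; apply: (@abs_summable_psum_ub _ (l1_norm b)) => A.
by rewrite (le_trans (le_psum _ ab))// psum_le_l1_norm.
Qed.

Lemma l1_norm_le a b : (forall x, `|a x| <= `|b x|) ->
  abs_summable b -> l1_norm a <= l1_norm b.
Proof.
move=> ab sb; apply: l1_norm_psum_ub => A.
by rewrite (le_trans (le_psum _ ab))// psum_le_l1_norm.
Qed.

Lemma ler_l1_normD a b : abs_summable a -> abs_summable b ->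
  l1_norm (a + b) <= l1_norm a + l1_norm b.
Proof.
move=> sa sb; apply: l1_norm_psum_ub => A; rewrite -[a]scale1r.
rewrite (le_trans (psum_abs_linear _ _ _ _))// normr1 mul1r.
by rewrite scale1r lerD ?psum_le_l1_norm.
Qed.

Lemma abs_summableZ c a : abs_summable a -> abs_summable (c *: a).
Proof.
by move=> sa; rewrite -[_ *: _]addr0; exact: abs_summable_linear abs_summable0.
Qed.

Lemma l1_normZ c a : abs_summable a -> l1_norm (c *: a) = `|c| * l1_norm a.
Proof.
have le k b : abs_summable b -> l1_norm (k *: b) <= `|k| * l1_norm b.
  move=> sb; apply: l1_norm_psum_ub => A; rewrite -[_ *: _]addr0.
  rewrite (le_trans (psum_abs_linear _ _ _ _))// [psum (abs 0) A]psumE.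
  rewrite [X in _ + X]big1 ?addr0 ?ler_wpM2l ?psum_le_l1_norm//.
  by move=> x _; rewrite normr0.
move=> sa; have [->|c0] := eqVneq c 0.
  rewrite normr0 mul0r; apply/eqP; rewrite eq_le l1_norm_ge0 andbT.
  by rewrite (le_trans (le _ _ sa))// normr0 mul0r.
apply/eqP; rewrite eq_le le//= -ler_pdivlMl ?normr_gt0//.
rewrite -normfV (le_trans _ (le _ _ (abs_summableZ c sa)))//.
by rewrite scalerA mulVf// scale1r.
Qed.

Lemma l1_norm_eq0 a : abs_summable a -> l1_norm a = 0 -> a = 0.
Proof.
move=> sa a0; apply/funext => x; apply/normr0_eq0/eqP.
rewrite eq_le normr_ge0 andbT -a0.
by have := psum_le_l1_norm [fset x]%fset sa; rewrite psumE big_seq_fset1.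
Qed.

Lemma bounded_fun_leP a : bounded_fun a <-> exists M, forall x, `|a x| <= M.
Proof.
split=> [/pinfty_ex_gt0[M _ aM]|[M aM]].
  by exists M => x; exact: aM.
exists M; split; first exact: num_real.
by move=> N /ltW MN x _; rewrite /= (le_trans (aM x)).
Qed.

Lemma le_linf_norm a x : bounded_fun a -> `|a x| <= linf_norm a.
Proof.
move=> /bounded_fun_leP[M aM]; apply: ub_le_sup; last by exists x.
by exists M => _ [y _ <-]; exact: aM.
Qed.

Lemma linf_norm_ub a M : 0 <= M -> (forall x, `|a x| <= M) -> linf_norm a <= M.
Proof.
move=> M0 aM; rewrite /linf_norm.
have [->|/set0P ne] := eqVneq (range (abs a)) set0; first by rewrite sup0.
by apply: ge_sup => // _ [x _ <-].
Qed.

Lemma linf_norm_ge0 a : bounded_fun a -> 0 <= linf_norm a.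
Proof.
move=> ba; rewrite /linf_norm.
have [->|/set0P[_ [x _ _]]] := eqVneq (range (abs a)) set0; first by rewrite sup0.
by rewrite (le_trans _ (le_linf_norm x ba)).
Qed.

Lemma bounded_fun_linear c a b :
  bounded_fun a -> bounded_fun b -> bounded_fun (c *: a + b).
Proof.
move=> ba bb; apply/bounded_fun_leP.
exists (`|c| * linf_norm a + linf_norm b) => x.
rewrite (le_trans (ler_normD _ _))// lerD ?le_linf_norm//.
by rewrite normrM ler_wpM2l// le_linf_norm.
Qed.

Lemma bounded_fun0 : bounded_fun (0 : T -> R).
Proof. by apply/bounded_fun_leP; exists 0 => x; rewrite normr0. Qed.

Lemma ler_linf_normD a b : bounded_fun a -> bounded_fun b ->
  linf_norm (a + b) <= linf_norm a + linf_norm b.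
Proof.
move=> ba bb; apply: linf_norm_ub => [|x]; first by rewrite addr_ge0 ?linf_norm_ge0.
by rewrite (le_trans (ler_normD _ _))// lerD ?le_linf_norm.
Qed.

Lemma linf_normZ c a : bounded_fun a -> linf_norm (c *: a) = `|c| * linf_norm a.
Proof.
have le k b : bounded_fun b -> linf_norm (k *: b) <= `|k| * linf_norm b.
  move=> bb; apply: linf_norm_ub => [|x]; first by rewrite mulr_ge0 ?linf_norm_ge0.
  by rewrite normrM ler_wpM2l// le_linf_norm.
move=> ba; have bca : bounded_fun (c *: a).
  by rewrite -[_ *: _]addr0; exact: bounded_fun_linear bounded_fun0.
have [->|c0] := eqVneq c 0.
  apply/eqP; rewrite eq_le le//= normr0 mul0r linf_norm_ge0//.
  by rewrite scale0r; exact: bounded_fun0.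
apply/eqP; rewrite eq_le le//= -ler_pdivlMl ?normr_gt0//.
rewrite -normfV (le_trans _ (le _ _ bca))//.
by rewrite scalerA mulVf// scale1r.
Qed.

Lemma linf_norm_eq0 a : bounded_fun a -> linf_norm a = 0 -> a = 0.
Proof.
move=> ba a0; apply/funext => x; apply/normr0_eq0/eqP.
by rewrite eq_le normr_ge0 andbT -a0 le_linf_norm.
Qed.

Lemma cvg_psum_ge0 a : (forall x, 0 <= a x) -> abs_summable a ->
  psum a A @[A --> summability.totally] --> l1_norm a.
Proof.
move=> a0 sa.
have aE : abs a = a by apply/funext => x; rewrite ger0_norm.
apply/cvgrPdist_le => e e0.
have [A lA] : exists A : {fset T}, l1_norm a - e < psum a A.
  apply: contrapT => /forallNP h.
  have : l1_norm a <= l1_norm a - e.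
    by apply: l1_norm_psum_ub => A; rewrite aE leNgt; apply/negP.
  by rewrite leNgt ltrBlDr ltrDl e0.
exists A => // B AB /=.
have lB := psum_le_l1_norm B sa; rewrite aE in lB.
rewrite ger0_norm ?subr_ge0// lerBlDr -lerBlDl (le_trans (ltW lA))//.
rewrite !psumE; have /fsetIidPr AB' := AB.
rewrite (big_fsetID _ (mem A) B)/= (_ : [fset x in B | x \in A]%fset = A).
  by rewrite lerDl sumr_ge0.
by rewrite -[RHS]AB'; apply/fsetP => x; rewrite !inE.
Qed.

Lemma is_cvg_psum a : abs_summable a ->
  cvg (psum a A @[A --> summability.totally]).
Proof.
move=> sa; have sab : abs_summable (abs a).
  by apply: abs_summable_le sa => x; rewrite normr_id.
have sp : abs_summable (a + abs a).
  by rewrite -{1}[a]scale1r; exact: abs_summable_linear.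
have c1 : psum (a + abs a) A @[A --> summability.totally] --> l1_norm (a + abs a).
  apply: cvg_psum_ge0 => // x.
  rewrite -[_ x]/(a x + `|a x|) -lerBlDl sub0r -normrN; exact: ler_norm.
have c2 := @cvg_psum_ge0 (abs a) (fun x => normr_ge0 (a x)) sab.
apply/cvg_ex; exists (l1_norm (a + abs a) - l1_norm (abs a)).
rewrite (_ : psum a = fun A => psum (a + abs a) A - psum (abs a) A).
  exact: cvgB.
by apply/funext => A; rewrite !psumE -sumrB; apply: eq_bigr => x _; rewrite addrK.
Qed.

Lemma sum_linear c a b : abs_summable a -> abs_summable b ->
  summability.sum (c *: a + b) = c * summability.sum a + summability.sum b.
Proof.
move=> /is_cvg_psum sa /is_cvg_psum sb.
apply/cvg_lim; first exact: norm_hausdorff.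
rewrite (_ : psum _ = fun A => c * psum a A + psum b A); last first.
  by apply/funext => A; rewrite psum_linear.
apply: cvgD; last exact: sb.
by apply: cvgMl_tmp; exact: sa.
Qed.

Lemma sum_le_l1_norm a : abs_summable a -> `|summability.sum a| <= l1_norm a.
Proof.
move=> sa; have c := is_cvg_psum sa.
rewrite -(lim_norm c); apply: limr_le; first exact: is_cvg_norm.
apply: nearW => A; rewrite (le_trans _ (psum_le_l1_norm A sa))//.
exact: ler_norm_sum.
Qed.

End families.

Section l1.
Context (T : choiceType) (R : realType).

Definition l1_pred : {pred T -> R} := mem [set a | abs_summable a].

Record l1 := L1 { l1_fun :> T -> R; l1_funP : l1_fun \in l1_pred }.

HB.instance Definition _ := [isSub for l1_fun].
HB.instance Definition _ := [Choice of l1 by <:].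

Lemma l1_summable (a : l1) : abs_summable a.
Proof. by have := l1_funP a; rewrite inE. Qed.

Lemma l1_submod_closed : submod_closed l1_pred.
Proof.
split=> [|c a b]; rewrite !inE; first exact: abs_summable0.
exact: abs_summable_linear.
Qed.

HB.instance Definition _ := GRing.isSubmodClosed.Build _ _ l1_pred l1_submod_closed.
HB.instance Definition _ := [SubChoice_isSubLmodule of l1 by <:].

Let nrm (a : l1) : R := l1_norm a.

Let nrmD (a b : l1) : nrm (a + b) <= nrm a + nrm b.
Proof. by apply: ler_l1_normD; exact: l1_summable. Qed.

Let nrmZ (c : R) (a : l1) : nrm (c *: a) = `|c| * nrm a.
Proof. by apply: l1_normZ; exact: l1_summable. Qed.

Let nrm_eq0 (a : l1) : nrm a = 0 -> a = 0.
Proof. by move=> a0; apply/val_inj/l1_norm_eq0 => //; exact: l1_summable. Qed.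

HB.instance Definition _ := Lmodule_isNormed.Build R l1 nrmD nrmZ nrm_eq0.

Lemma l1_normE (a : l1) : `|a| = l1_norm a. Proof. by []. Qed.

End l1.

Section linf.
Context (T : choiceType) (R : realType).

Definition linf_pred : {pred T -> R} := mem [set f | bounded_fun f].

Record linf := Linf { linf_fun :> T -> R; linf_funP : linf_fun \in linf_pred }.

HB.instance Definition _ := [isSub for linf_fun].
HB.instance Definition _ := [Choice of linf by <:].

Lemma linf_bounded (f : linf) : bounded_fun f.
Proof. by have := linf_funP f; rewrite inE. Qed.

Lemma linf_submod_closed : submod_closed linf_pred.
Proof.
split=> [|c a b]; rewrite !inE; first exact: bounded_fun0.
exact: bounded_fun_linear.
Qed.

HB.instance Definition _ :=
  GRing.isSubmodClosed.Build _ _ linf_pred linf_submod_closed.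
HB.instance Definition _ := [SubChoice_isSubLmodule of linf by <:].

Let nrm (f : linf) : R := linf_norm f.

Let nrmD (f g : linf) : nrm (f + g) <= nrm f + nrm g.
Proof. by apply: ler_linf_normD; exact: linf_bounded. Qed.

Let nrmZ (c : R) (f : linf) : nrm (c *: f) = `|c| * nrm f.
Proof. by apply: linf_normZ; exact: linf_bounded. Qed.

Let nrm_eq0 (f : linf) : nrm f = 0 -> f = 0.
Proof. by move=> f0; apply/val_inj/linf_norm_eq0 => //; exact: linf_bounded. Qed.

HB.instance Definition _ := Lmodule_isNormed.Build R linf nrmD nrmZ nrm_eq0.

Lemma linf_normE (f : linf) : `|f| = linf_norm f. Proof. by []. Qed.

End linf.

Section hankel.
Context (R : realType) (Sigma : finType) (L : set (seq Sigma)).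

Definition hankel_family (a : seq Sigma -> R) (v : seq Sigma) : seq Sigma -> R :=
  fun u => a u * \1_L (u ++ v).

Definition hankel_fun (a : seq Sigma -> R) : seq Sigma -> R :=
  fun v => summability.sum (hankel_family a v).

Lemma hankel_family_le (a : seq Sigma -> R) v u : `|hankel_family a v u| <= `|a u|.
Proof.
rewrite normrM indicE; case: (_ \in _) => /=; first by rewrite normr1 mulr1.
by rewrite normr0 mulr0.
Qed.

Lemma hankel_family_summable (a : l1 (seq Sigma) R) v :
  abs_summable (hankel_family a v).
Proof. by apply: abs_summable_le (l1_summable a) => u; exact: hankel_family_le. Qed.

Lemma hankel_fun_le (a : l1 (seq Sigma) R) v : `|hankel_fun a v| <= `|a|.
Proof.
rewrite (le_trans (sum_le_l1_norm (hankel_family_summable a v)))//.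
by apply: l1_norm_le (l1_summable a) => u; exact: hankel_family_le.
Qed.

Lemma hankel_fun_bounded (a : l1 (seq Sigma) R) :
  hankel_fun a \in @linf_pred (seq Sigma) R.
Proof. by rewrite inE; apply/bounded_fun_leP; exists `|a|; exact: hankel_fun_le. Qed.

Definition hankel (a : l1 (seq Sigma) R) : linf (seq Sigma) R :=
  Linf (hankel_fun_bounded a).

Lemma hankel_is_linear : linear hankel.
Proof.
move=> c a b; apply/val_inj/funext => v /=.
rewrite /hankel_fun -[RHS]/(c * _ + _) -sum_linear; last 2 first.
- exact: hankel_family_summable.
- exact: hankel_family_summable.
congr summability.sum; apply/funext => u.
rewrite -[LHS]/((c * a u + b u) * _) -[RHS]/(c * (a u * _) + b u * _).
by rewrite mulrDl mulrA.
Qed.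

HB.instance Definition _ := GRing.isLinear.Build R _ _ _ hankel hankel_is_linear.

Lemma hankel_continuous : continuous hankel.
Proof.
apply/linear_bounded_continuous/bounded_funP => r; exists r => a ar.
rewrite (le_trans _ ar)// linf_normE; apply: linf_norm_ub => //.
exact: hankel_fun_le.
Qed.

End hankel.

Arguments hankel R {Sigma} L a.

(* Main.v *)
Require Import Defs.
From HB Require Import structures.
From mathcomp Require Import all_boot all_order all_algebra finmap.
From mathcomp Require Import all_classical all_reals all_analysis.
From mathcomp Require summability.

(** The Hankel operator sends the unit family at a word [u] to the row of [u],
    the 0/1-valued function [v |-> 1_L (u ++ v)], which encodes the residual of
    [L] by [u] ([hankel_delta]).  By Myhill and Nerode, [L] is regular exactly
    when it has finitely many residuals, so everything reduces to relating the
    operator to the set of its rows.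

    If [L] is regular, then rows depend only on the state that [u] leads to, so
    grouping the coefficients of [a] by state yields
    [H a = \sum_i c_i(a) *: r_i] with finitely many rows [r_i] and
    [`|c_i(a)| <= `|a|] ([hankel_sum_rows], [mass_le]).  The range is thus the
    span of the [r_i], and the image of a bounded set lies in the continuous
    image of a compact box of coefficients.  Since the coefficients are bounded
    explicitly, compactness needs no comparison of norms on the range.

    Conversely, each of the two analytic properties leaves room for finitely
    many 0/1-valued functions only.  On a finite-dimensional space of functions,
    an element is determined by its values at finitely many points
    ([separating_points]), and a row takes only two values at each of them.
    Distinct rows lie at distance at least 1, while a compact set is covered by
    finitely many balls of radius 1/2.  Finite rank implies compactness, and
    conversely, by passing through regularity. *)

Set Implicit Arguments.
Unset Strict Implicit.
Unset Printing Implicit Defensive.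

Import Order.TTheory GRing.Theory Num.Theory numFieldNormedType.Exports.

Local Open Scope classical_set_scope.
Local Open Scope ring_scope.

(** * Regularity and residuals *)

(** The common form of both finiteness arguments for rows: [phi] records either
    the values at separating points or the ball that contains the row. *)
Lemma finite_range_factor (A : choiceType) (B : Type) (K : finType)
    (f : A -> B) (phi : A -> K) :
  (forall x y, phi x = phi y -> f x = f y) -> finite_set (range f).
Proof.
move=> fphi; have [nA|nA] := pselect (inhabited A); last first.
  rewrite (_ : range f = set0); first exact: finite_set0.
  by apply/seteqP; split=> // y [a _ _]; case: nA.
case: nA => a.
pose g k := f (xget a [set x | phi x = k]).
apply: (@sub_finite_set _ _ (range g)); last exact: finite_image.
move=> _ [x _ <-]; exists (phi x) => //; apply: fphi.
by rewrite (@xgetPex _ a [set y | phi y = phi x]) //; exists x.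
Qed.

Section residuals.
Context (Sigma : finType).
Implicit Types (L : set (seq Sigma)) (u v w : seq Sigma).

Definition residual L u : set (seq Sigma) := [set v | L (u ++ v)].

Lemma regular_factor L : regular L ->
  exists n (phi : seq Sigma -> 'I_n),
    forall u u', phi u = phi u' -> residual L u = residual L u'.
Proof.
case=> M ->; exists #|dfa_state M|.
exists (fun u => enum_rank (foldl (@dfa_trans _ M) (dfa_init M) u)).
move=> u u' /enum_rank_inj uu'; apply/funext => v.
by rewrite /residual/= /dfa_accepts !foldl_cat uu'.
Qed.

(** The residuals themselves are the states of an automaton: reading a letter
    [x] replaces a residual by its own residual by [x], and a state is final
    when it contains the empty word. *)
Lemma finite_residuals_regular L :
  finite_set (range (residual L)) -> regular L.
Proof.
move=> finL; pose K := fset_set (range (residual L)).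
have inK u : residual L u \in K by rewrite in_fset_set // inE; exists u.
pose q0 : K := FSetSub (inK [::]).
(* The default value of insubd is never reached from q0: see state below. *)
pose step (q : K) (x : Sigma) : K := insubd q [set v | val q (x :: v)].
pose M := Dfa q0 step [set q : K | `[< val q [::] >]].
have state u : val (foldl step q0 u) = residual L u.
  elim/last_ind: u => [//|u x IH]; rewrite foldl_rcons.
  have E : [set v | residual L u (x :: v)] = residual L (rcons u x).
    by apply/funext => v; rewrite /residual/= -cats1 -catA.
  by rewrite /step val_insubd IH E inK.
exists M; apply/funext => w; rewrite /= /dfa_accepts inE state /residual/= cats0.
by apply/propext; split=> /asboolP.
Qed.

End residuals.

(** * Unit families and sums *)

Section families.
Context (R : realType) (T : choiceType).

Definition delta_fun (u : T) : T -> R := fun x => (x == u)%:R.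

Lemma psum_delta_le1 (u : T) (A : {fset T}) :
  summability.partial_sum (fun x => `|delta_fun u x|) A <= 1.
Proof.
rewrite psumE; have [uA|uA] := boolP (u \in A).
  rewrite (big_fsetD1 u) //= /delta_fun eqxx normr1 big1_seq ?addr0 // => x /=.
  by rewrite !inE => /andP[/negbTE -> _]; rewrite normr0.
rewrite big1_seq // => x /= xA; rewrite /delta_fun (_ : x == u = false) ?normr0 //.
by apply: contraNF uA => /eqP <-.
Qed.

Lemma abs_summable_delta (u : T) : abs_summable (delta_fun u).
Proof. exact: abs_summable_psum_ub (psum_delta_le1 u). Qed.

Lemma delta_in_l1 (u : T) : delta_fun u \in @l1_pred T R.
Proof. by rewrite inE; exact: abs_summable_delta. Qed.

Definition delta (u : T) : l1 T R := L1 (delta_in_l1 u).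

Lemma l1_norm_delta (u : T) : l1_norm (delta_fun u) = 1.
Proof.
apply/eqP; rewrite eq_le l1_norm_psum_ub; last exact: psum_delta_le1.
have := psum_le_l1_norm [fset u]%fset (abs_summable_delta u).
by rewrite psumE big_seq_fset1 /delta_fun eqxx normr1.
Qed.

Lemma sum_delta (u : T) : summability.sum (delta_fun u) = 1.
Proof.
rewrite -(l1_norm_delta u); apply/cvg_lim; first exact: norm_hausdorff.
by apply: cvg_psum_ge0 => [x|]; [exact: ler0n|exact: abs_summable_delta].
Qed.

Lemma sumZ (c : R) (a : T -> R) : abs_summable a ->
  summability.sum (c *: a) = c * summability.sum a.
Proof.
move=> sa; have s0 : summability.sum (0 : T -> R) = 0.
  have := sum_linear 1 (@abs_summable0 T R) (@abs_summable0 T R).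
  by rewrite scale1r addr0 mul1r => /esym/eqP; rewrite -subr_eq0 addrK => /eqP.
by rewrite -[c *: a]addr0 sum_linear ?s0 ?addr0 //; exact: abs_summable0.
Qed.

Lemma linf_sumE (I : Type) (r : seq I) (F : I -> linf T R) x :
  (\sum_(i <- r) F i : linf T R) x = \sum_(i <- r) F i x.
Proof. exact: (@big_morph _ _ (fun f : linf T R => f x) 0 +%R 0 +%R). Qed.

Lemma l1_sumE (I : Type) (r : seq I) (F : I -> l1 T R) x :
  (\sum_(i <- r) F i : l1 T R) x = \sum_(i <- r) F i x.
Proof. exact: (@big_morph _ _ (fun f : l1 T R => f x) 0 +%R 0 +%R). Qed.

End families.

(** Induction on the size of the family.  If [e ord0] does not vanish at [x0],
    subtracting multiples of it makes the other functions vanish at [x0]; a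
    combination that vanishes at [x0] is then a combination of these corrected
    functions, to which the induction hypothesis applies. *)
Lemma separating_points (F : fieldType) (T : eqType) n (e : 'I_n -> T -> F) :
  exists s : seq T, forall c : 'I_n -> F,
    (forall x, x \in s -> \sum_i c i * e i x = 0) ->
    forall x, \sum_i c i * e i x = 0.
Proof.
elim: n e => [|n IH] e; first by exists [::] => c _ x; rewrite big_ord0.
have [[x0 ex0]|e0] := pselect (exists x, e ord0 x != 0); last first.
  have e00 x : e ord0 x = 0 by apply/eqP; apply: contra_notT e0 => ?; exists x.
  have [s sP] := IH (fun i => e (lift ord0 i)); exists s => c cs x.
  rewrite big_ord_recl e00 mulr0 add0r; apply: (sP (fun i => c (lift ord0 i))).
  by move=> y /cs; rewrite big_ord_recl e00 mulr0 add0r.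
pose k i := e (lift ord0 i) x0 / e ord0 x0.
have [s sP] := IH (fun i x => e (lift ord0 i) x - k i * e ord0 x).
exists (x0 :: s) => c cs.
(* Vanishing at x0 expresses the first coefficient through the others. *)
have c0 : c ord0 = - \sum_i c (lift ord0 i) * k i.
  have := cs x0 (mem_head _ _); rewrite big_ord_recl => /eqP.
  rewrite addr_eq0 => /eqP /(canRL (mulfK ex0)) ->.
  by rewrite mulNr mulr_suml; congr (- _); apply: eq_bigr => i _; rewrite mulrA.
have cE x : \sum_i c i * e i x =
    \sum_i c (lift ord0 i) * (e (lift ord0 i) x - k i * e ord0 x).
  rewrite big_ord_recl c0 mulNr mulr_suml addrC -sumrB.
  by apply: eq_bigr => i _; rewrite mulrBr [in RHS]mulrA.
move=> x; rewrite cE; apply: (sP (fun i => c (lift ord0 i))) => y ys.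
by rewrite -cE cs // inE ys orbT.
Qed.

(** * Rows of the Hankel operator *)

Section hankel_operator.
Context (R : realType) (Sigma : finType) (L : set (seq Sigma)).
Implicit Types u v w : seq Sigma.

Lemma hankel_delta u v : hankel R L (delta R u) v = \1_L (u ++ v).
Proof.
rewrite /hankel/= /hankel_fun.
rewrite (_ : hankel_family _ _ _ = \1_L (u ++ v) *: delta_fun R u).
  by rewrite sumZ ?sum_delta ?mulr1 //; exact: abs_summable_delta.
apply/funext => x; rewrite /hankel_family /= -[RHS]/(_ * delta_fun R u x).
by rewrite /delta_fun mulrC; case: eqP => [->//|_]; rewrite !mulr0.
Qed.

Lemma indic_inj u v : \1_L u = \1_L v :> R -> L u = L v.
Proof.
rewrite !indicE => /eqP; rewrite eqr_nat => /eqP uv.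
have {}uv : (u \in L) = (v \in L) by move: uv; do 2 case: (_ \in L).
by rewrite -(in_setE L u) -(in_setE L v) uv.
Qed.

Lemma residual_eq_hankel u u' :
  (forall v, hankel R L (delta R u) v = hankel R L (delta R u') v) ->
  residual L u = residual L u'.
Proof.
move=> uu'; apply/funext => v; apply: indic_inj.
by rewrite -!hankel_delta.
Qed.

(** The difference of two rows lies in the range, hence in the span of finitely
    many functions; so a row is determined by its 0/1 values at a finite set of
    separating points, which leaves finitely many rows. *)
Lemma finite_rank_finite_residuals :
  finite_rank (hankel R L) -> finite_set (range (residual L)).
Proof.
move=> [n [e rE]].
have [s sP] := separating_points (fun i => e i : seq Sigma -> R).
apply: (@finite_range_factor _ _ {ffun 'I_(size s) -> bool} _
  (fun u => [ffun i : 'I__ => u ++ nth [::] s i \in L])) => u u' uu'.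
have : range (hankel R L) (hankel R L (delta R u - delta R u')).
  by exists (delta R u - delta R u').
rewrite rE => -[c cE].
have dE v : \sum_i c i * e i v = \1_L (u ++ v) - \1_L (u' ++ v).
  rewrite -!hankel_delta.
  rewrite -[RHS]/((hankel R L (delta R u) - hankel R L (delta R u') : linf _ _) v).
  by rewrite -linearB [X in linf_fun X]cE linf_sumE.
apply: residual_eq_hankel => v; apply/eqP; rewrite -subr_eq0 !hankel_delta -dE.
apply/eqP/sP => x xs; rewrite dE !indicE.
move/ffunP/(_ (Ordinal (etrans (index_mem x s) xs))) : uu'; rewrite !ffunE /=.
by rewrite nth_index // => ->; rewrite subrr.
Qed.

(** The unit families lie in the unit ball, so all rows lie in one compact set,
    covered by finitely many balls of radius 1/2.  Two rows in the same ball are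
    at distance less than 1 and, being 0/1-valued, coincide. *)
Lemma compact_finite_residuals :
  compact_operator (hankel R L) -> finite_set (range (residual L)).
Proof.
move=> cL; pose B := [set a : l1 (seq Sigma) R | `|a| <= 1].
have bB : bounded_set B.
  by exists 1; split; [exact: num_real|move=> M /ltW M1 a Ba; exact: le_trans M1].
have deltaB u : B (delta R u) by rewrite /B/= l1_normE l1_norm_delta.
have [K HK [+ _]] := cL _ bB; rewrite compact_cover.
move=> /(_ _ [set: linf (seq Sigma) R] (fun f => ball f 2^-1)).
case=> [f _|f _|D _ KD]; first exact: ball_open.
  by exists f => //; exact: ballxx.
have /choice[phi phiP] u :
    exists d : D, ball (val d) 2^-1 (hankel R L (delta R u)).
  have /KD[d dD hd] : K (hankel R L (delta R u)).
    by apply: HK; exists (delta R u).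
  by exists (FSetSub dD).
apply: (@finite_range_factor _ _ D _ phi) => u u' uu'.
have lt1 : `|hankel R L (delta R u) - hankel R L (delta R u')| < 1.
  have h u0 : `|val (phi u0) - hankel R L (delta R u0)| < 2^-1.
    by have := phiP u0; rewrite -ball_normE.
  rewrite [1]splitr -(subrKA (val (phi u))) (le_lt_trans (ler_normD _ _)) //.
  by rewrite ltrD ?div1r // ?[in X in _ < X]uu' ?uu' // distrC -?uu'.
apply: residual_eq_hankel => v; apply/eqP.
have : `|hankel R L (delta R u) v - hankel R L (delta R u') v| < 1.
  apply: le_lt_trans lt1; rewrite linf_normE.
  exact: le_linf_norm v (linf_bounded
    (hankel R L (delta R u) - hankel R L (delta R u'))).
rewrite !hankel_delta !indicE; do 2 case: (_ \in L) => //=.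
- by rewrite subr0 normr1 ltxx.
- by rewrite sub0r normrN normr1 ltxx.
Qed.

(** * The operator of a language with finitely many residuals *)

Section factored.
Context (n : nat) (phi : seq Sigma -> 'I_n).
Hypothesis phi_residual :
  forall u u', phi u = phi u' -> residual L u = residual L u'.

Definition fiber_fun (a : seq Sigma -> R) (i : 'I_n) : seq Sigma -> R :=
  fun u => if phi u == i then a u else 0.

Lemma fiber_fun_le a i u : `|fiber_fun a i u| <= `|a u|.
Proof. by rewrite /fiber_fun; case: ifP; rewrite // normr0. Qed.

Lemma fiber_in_l1 (a : l1 (seq Sigma) R) i :
  fiber_fun a i \in @l1_pred (seq Sigma) R.
Proof.
by rewrite inE; apply: abs_summable_le (l1_summable a) => u; exact: fiber_fun_le.
Qed.

Definition fiber (a : l1 (seq Sigma) R) i : l1 (seq Sigma) R :=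
  L1 (fiber_in_l1 a i).

Definition mass (a : l1 (seq Sigma) R) i : R := summability.sum (fiber a i).

(** When [i] is not a value of [phi] the word is [[::]], so that every [rep_row]
    is a genuine row and lies in the range of the operator; the coefficient
    [mass a i] is then zero. *)
Definition rep_word i : seq Sigma := xget [::] [set u | phi u = i].

Definition rep_row i : linf (seq Sigma) R := hankel R L (delta R (rep_word i)).

Lemma phi_rep_word u : phi (rep_word (phi u)) = phi u.
Proof.
by rewrite /rep_word (@xgetPex _ [::] [set w | phi w = phi u]) //; exists u.
Qed.

Lemma mass_le a i : `|mass a i| <= `|a|.
Proof.
rewrite (le_trans (sum_le_l1_norm (l1_summable _))) // l1_normE.
by apply: l1_norm_le (l1_summable a) => u; exact: fiber_fun_le.
Qed.

Lemma sum_fiber a : a = \sum_i fiber a i.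
Proof.
apply/val_inj/funext => u; rewrite -[RHS]/((\sum_i fiber a i : l1 _ _) u) l1_sumE.
rewrite (bigD1 (phi u)) //= /fiber_fun eqxx big1 ?addr0 // => i.
by rewrite eq_sym => /negbTE ->.
Qed.

(** All words in a fiber have the same row, which factors out of the sum. *)
Lemma hankel_fiber a i : hankel R L (fiber a i) = mass a i *: rep_row i.
Proof.
apply/val_inj/funext => v; rewrite -[RHS]/(_ * rep_row i v) hankel_delta mulrC.
rewrite -sumZ; last exact: l1_summable.
rewrite /= /hankel_fun; congr summability.sum; apply/funext => u.
rewrite -[RHS]/(_ * fiber_fun a i u) /hankel_family /= mulrC /fiber_fun.
case: eqP => [<-|_]; last by rewrite !mulr0.
congr (_ * _); rewrite !indicE -[u ++ v \in L]/(`[< residual L u v >]).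
by rewrite -(phi_residual (phi_rep_word u)).
Qed.

Lemma hankel_sum_rows a : hankel R L a = \sum_i mass a i *: rep_row i.
Proof.
rewrite [in LHS](sum_fiber a) linear_sum.
by apply: eq_bigr => i _; exact: hankel_fiber.
Qed.

Lemma hankel_finite_rank : finite_rank (hankel R L).
Proof.
exists n, rep_row; apply/seteqP; split=> [_ [a _ <-]|_ [c ->]].
  by exists (mass a); exact: hankel_sum_rows.
exists (\sum_i c i *: delta R (rep_word i)) => //.
by rewrite linear_sum; apply: eq_bigr => i _; rewrite linearZ.
Qed.

(** A bound [M] on a set of families bounds every [mass] by [M], so the image
    is contained in the continuous image of the compact box of coefficient
    vectors with entries between [- M] and [M]. *)
Lemma hankel_compact : compact_operator (hankel R L).
Proof.
move=> A /pinfty_ex_gt0[M _ AM].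
pose box := [set c : 'rV[R]_n | forall i, `[- M, M]%classic (c ord0 i)].
pose comb (c : 'rV[R]_n) : linf (seq Sigma) R := \sum_i c ord0 i *: rep_row i.
apply: (@precompact_subset _ _ (comb @` box)).
  move=> _ [a Aa <-]; exists (\row_i mass a i); last first.
    by rewrite [RHS]hankel_sum_rows; apply: eq_bigr => i _; rewrite mxE.
  move=> i /=; rewrite mxE in_itv /= -ler_norml.
  exact: le_trans (mass_le a i) (AM _ Aa).
apply: compact_precompact; first exact: norm_hausdorff.
apply: continuous_compact; last first.
  apply: (@rV_compact R n (fun=> `[- M, M]%classic)) => i.
  exact: segment_compact.
apply: continuous_subspaceT; apply: continuous_big => [|i _].
  exact: add_continuous.
by move=> c; exact: cvgZr_tmp (@coord_continuous R 1 n ord0 i c).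
Qed.

End factored.

End hankel_operator.

(** * The equivalence *)

Theorem theorem8p4 (R : realType) (Sigma : finType) (hSigma : (0 < #|Sigma|)%N)
    (L : set (seq Sigma)) :
  (regular L <-> finite_rank (hankel R L)) /\
  (finite_rank (hankel R L) <-> compact_operator (hankel R L)).
Proof.
have rank_reg : finite_rank (hankel R L) -> regular L.
  by move=> /finite_rank_finite_residuals; exact: finite_residuals_regular.
have compact_reg : compact_operator (hankel R L) -> regular L.
  by move=> /compact_finite_residuals; exact: finite_residuals_regular.
have reg_rank : regular L -> finite_rank (hankel R L).
  by case/regular_factor => n [phi]; exact: hankel_finite_rank.
have reg_compact : regular L -> compact_operator (hankel R L).
  by case/regular_factor => n [phi]; exact: hankel_compact.
by split; split; auto.
Qed.
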